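(* If $i\ge2$, then the vincular patterns $1^i3\text{-}2$ and $13^i\text{-}2$ are Wilf-equivalent.
   Context: For $k\ge1$ let $[k]=\{1,\dots,k\}$; a $k$-ary word of length $n$ is an element of $[k]^n$. $a^i$ denotes $i$ consecutive copies of the letter $a$. Two words are order-isomorphic if replacing the $i$-th smallest distinct letter by $i$ yields the same word. A vincular pattern $\alpha\text{-}b$ with $\alpha$ a word of length $m$ and $b$ a single letter occurs in $w=w_1\cdots w_n$ if there are indices $p$ and $q\ge p+m$ with $w_p\cdots w_{p+m-1}w_q$ order-isomorphic to $\alpha b$; otherwise $w$ avoids it. Thus $1^i3\text{-}2$ has underlying word $1^i32$ and $13^i\text{-}2$ has underlying word $13^i2$. For a pattern $\sigma$, $a_\sigma(n,k)$ is the number of words in $[k]^n$ avoiding $\sigma$; $\sigma\sim\tau$ (Wilf-equivalence) means $a_\sigma(n,k)=a_\tau(n,k)$ for all $n\ge0,k\ge1$. *)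

(* Defs.v *)
From mathcomp Require Import all_boot.

Set Implicit Arguments.
Unset Strict Implicit.
Unset Printing Implicit Defensive.

(* The reduction of s: its i-th smallest distinct letter is replaced by i,
   counting from i = 1. *)
Definition reduction (s : seq nat) : seq nat :=
  [seq (index x (sort leq (undup s))).+1 | x <- s].

Definition order_isomorphic (s t : seq nat) : bool :=
  reduction s == reduction t.

(* VPattern alpha b is the vincular pattern written alpha-b: the letters of
   alpha must be matched by consecutive letters, b by any later letter. *)
Record vpattern := VPattern { vblock : seq nat; vlast : nat }.

Definition occurs (sigma : vpattern) (w : seq nat) : bool :=
  let m := size (vblock sigma) in
  [exists p : 'I_(size w), exists q : 'I_(size w),
     (p + m <= q) &&
     order_isomorphic (rcons (take m (drop p w)) (nth 0 w q))
                      (rcons (vblock sigma) (vlast sigma))].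

Definition avoids (sigma : vpattern) (w : seq nat) : bool := ~~ occurs sigma w.

(* A k-ary word of length n is an n.-tuple 'I_k, where j : 'I_k stands for the
   letter j + 1 of {1, ..., k}. *)
Definition letters (n k : nat) (w : n.-tuple 'I_k) : seq nat :=
  [seq (nat_of_ord x).+1 | x <- w].

Definition avoid_count (sigma : vpattern) (n k : nat) : nat :=
  #|[set w : n.-tuple 'I_k | avoids sigma (letters w)]|.

Definition wilf_equivalent (sigma tau : vpattern) : Prop :=
  forall n k : nat, 1 <= k -> avoid_count sigma n k = avoid_count tau n k.

Definition pattern_1i3_2 (i : nat) : vpattern := VPattern (rcons (nseq i 1) 3) 2.

Definition pattern_13i_2 (i : nat) : vpattern := VPattern (1 :: nseq i 3) 2.

(* Main.v *)
Require Import Defs.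
From mathcomp Require Import all_boot.

Set Implicit Arguments.
Unset Strict Implicit.
Unset Printing Implicit Defensive.

(** Write a word as its maximal runs x_1^{e_1} ... x_r^{e_r}, and call j a bad
    ascent if some x_l with l > j + 1 lies strictly between x_j and x_{j+1}.
    The word avoids 1^i3-2 iff e_j < i at every bad ascent j, and it avoids
    13^i-2 iff e_{j+1} < i at every bad ascent j.  Being a bad ascent depends
    only on the letters x_1 ... x_r, so permuting the exponents along each
    maximal block of consecutive bad ascents exchanges the two conditions. *)

(** * Run-length encoding *)

Section RunLength.

Variable T : eqType.
Implicit Types (x y : T) (w : seq T) (r : seq (T * nat)).

(* The pair (x, e) stands for the run of e.+1 copies of x. *)
Definition unruns r : seq T := flatten [seq nseq p.2.+1 p.1 | p <- r].

Fixpoint runs w : seq (T * nat) :=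
  if w is x :: w' then
    if runs w' is (y, e) :: r then
      if x == y then (y, e.+1) :: r else (x, 0) :: (y, e) :: r
    else [:: (x, 0)]
  else [::].

Definition distinct_adjacent : rel T := [rel x y | x != y].

Lemma runsK : cancel runs unruns.
Proof.
elim=> // x w IH /=; case E: (runs w) => [|[y e] r]; rewrite E in IH.
  by rewrite -IH.
by rewrite -IH; case: eqP => [->|].
Qed.

Lemma runs_sorted w : sorted distinct_adjacent (unzip1 (runs w)).
Proof.
elim: w => // x w /=; case: (runs w) => [|[y e] r] //= IH.
by case: eqVneq => //= neq_xy; rewrite IH andbT.
Qed.

Lemma runs_run x e w : ohead (unzip1 (runs w)) != Some x ->
  runs (nseq e.+1 x ++ w) = (x, e) :: runs w.
Proof.
move=> neq_x; elim: e => [|e IH].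
  rewrite /=; case: (runs w) neq_x => [|[y f] r] //= neq_x.
  by rewrite ifN //; apply: contraNneq neq_x => ->.
by rewrite -[nseq e.+2 x ++ w]/(x :: (nseq e.+1 x ++ w)) /= in IH *; rewrite IH eqxx.
Qed.

(** Together with [runsK] and [runs_sorted], this makes [runs] a bijection from words onto encodings
    whose adjacent letters differ. *)
Lemma unrunsK r : sorted distinct_adjacent (unzip1 r) -> runs (unruns r) = r.
Proof.
elim: r => // [[x e] r] IH /= x_r.
have r_sorted := path_sorted x_r.
rewrite -[RHS]/((x, e) :: r) -{2}(IH r_sorted).
apply: runs_run; rewrite (IH r_sorted).
case: r x_r {IH r_sorted} => //= p r /andP[neq _].
by apply: contraNneq neq => -[->].
Qed.

Lemma ohead_unruns r : ohead (unruns r) = ohead (unzip1 r).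
Proof. by case: r => [|[]]. Qed.

Lemma has_unruns (a : pred T) r : has a (unruns r) = has a (unzip1 r).
Proof.
by elim: r => //= -[x e] r IH; rewrite /= has_cat IH has_nseq; case: (a x); rewrite ?andbF.
Qed.

Lemma size_unruns r : size (unruns r) = sumn [seq p.2.+1 | p <- r].
Proof. by elim: r => //= -[x e] r IH; rewrite /= size_cat size_nseq IH. Qed.

(** As [s] does not begin with [x], the left side opens with exactly [m] copies of [x], so a prefix
    of [n] copies lies inside that run. *)
Lemma nseq_cat_inv x m n s t : ohead s != Some x ->
  nseq m x ++ s = nseq n x ++ t -> n <= m /\ t = nseq (m - n) x ++ s.
Proof.
move=> neq_x; elim: n m => [|n IH] [|m] //=.
- by move=> eq_s; rewrite eq_s eqxx in neq_x.
- by case=> /IH.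
Qed.

End RunLength.

Lemma map_unruns (T U : eqType) (f : T -> U) (r : seq (T * nat)) :
  map f (unruns r) = unruns [seq (f p.1, p.2) | p <- r].
Proof. by elim: r => //= -[x e] r IH; rewrite /= map_cat map_nseq IH. Qed.

(** * Shifting the exponents *)

Section Shift.

Variables (T : eqType) (i : nat) (bad : T -> seq T -> bool).
Implicit Types (x : T) (r : seq (T * nat)).

Fixpoint short_starts r : bool :=
  if r is (x, e) :: r' then
    (bad x (unzip1 r') ==> (e.+1 < i)) && short_starts r'
  else true.

Fixpoint short_ends r : bool :=
  if r is (x, _) :: r' then
    (bad x (unzip1 r') ==> (if r' is (_, f) :: _ then f.+1 < i else true)) &&
    short_ends r'
  else true.

(** The tail is shifted first, so along a maximal block of bad ascents the swaps compose to a cyclic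
    rotation: the last exponent moves to the front and every other one moves one run to the
    right. *)
Fixpoint shift_runs r : seq (T * nat) :=
  if r is (x, e) :: r' then
    if shift_runs r' is (y, f) :: r'' then
      if bad x (unzip1 r') then (x, f) :: (y, e) :: r''
      else (x, e) :: (y, f) :: r''
    else [:: (x, e)]
  else [::].

Lemma shift_runs_letters r : unzip1 (shift_runs r) = unzip1 r.
Proof.
elim: r => //= -[x e] r IH /=; move: IH.
case: (shift_runs r) => [|[y f] r'] /= <- //.
by case: ifP.
Qed.

Lemma shift_runs_total r :
  sumn [seq p.2.+1 | p <- shift_runs r] = sumn [seq p.2.+1 | p <- r].
Proof.
elim: r => //= -[x e] r IH /=; move: IH.
case: (shift_runs r) => [|[y f] r'] /= <- //.
by case: ifP => //= _; rewrite addnCA.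
Qed.

(** Both encodings carry the same letters, so [bad] takes the same branch at every level and each
    swap can be undone. *)
Lemma shift_runs_inj : injective shift_runs.
Proof.
move=> r1 r2 eq12.
have: unzip1 r1 = unzip1 r2 by rewrite -(shift_runs_letters r1) eq12 shift_runs_letters.
elim: r1 r2 eq12 => [|[x1 e1] r1 IH] [|[x2 e2] r2] //= eq12 [eq_x eq_r].
rewrite -{}eq_x -eq_r in eq12 *.
move: eq12 (IH r2).
case: (shift_runs r1) => [|[y1 f1] s1]; case: (shift_runs r2) => [|[y2 f2] s2] //=.
- by move=> [->] /(_ erefl eq_r)->.
- by case: ifP.
- by case: ifP.
- by case: ifP => _ [-> -> -> ->] /(_ erefl eq_r)->.
Qed.

(** At a bad ascent the second run receives the exponent that the first one had. The condition on
    the tail survives the swap because [short_ends] never tests the exponent of a first run. *)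
Lemma short_ends_shift_runs r : (forall x, bad x [::] = false) ->
  short_ends (shift_runs r) = short_starts r.
Proof.
move=> bad_nil; elim: r => //= -[x e] r <- /=.
have /= := shift_runs_letters r.
case: (shift_runs r) => [|[y f] s] /= <-; first by rewrite bad_nil.
by case: ifP => /= ->.
Qed.

End Shift.

(** * Occurrences of the two patterns *)

Definition straddled (a c : nat) (v : seq nat) : bool := has (fun b => a < b < c) v.

Definition bad_ascent (a : nat) (w : seq nat) : bool :=
  if w is c :: v then straddled a c v else false.

Lemma straddled_neq a c v : straddled a c v -> a != c.
Proof.
by case/hasP=> b _ /andP[ab bc]; rewrite neq_ltn (ltn_trans ab bc).
Qed.

(** Occurrences at position 0. If [w] has fewer than [m] letters then [drop m w] is empty, so
    [take m w] is only ever compared at full length. *)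
Definition starts (sigma : vpattern) (w : seq nat) : bool :=
  let m := size (vblock sigma) in
  has (fun b => order_isomorphic (rcons (take m w) b)
                                 (rcons (vblock sigma) (vlast sigma)))
      (drop m w).

Lemma occurs_has sigma w :
  occurs sigma w = has (fun p => starts sigma (drop p w)) (iota 0 (size w)).
Proof.
rewrite /occurs /starts; set m := size (vblock _).
apply/existsP/hasP => [[p /existsP[q /andP[le_q iso]]]|[p]].
  exists (p : nat); first by rewrite mem_iota ltn_ord.
  apply/hasP; exists (nth 0 w q) => //.
  rewrite drop_drop addnC -(subnKC le_q) -nth_drop mem_nth //.
  by rewrite size_drop ltn_sub2r // (leq_ltn_trans le_q).
rewrite mem_iota add0n => /= lt_p /hasP[b].
rewrite drop_drop => /(nthP 0)[j]; rewrite size_drop => lt_j <-.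
rewrite nth_drop => iso.
have lt_q : m + p + j < size w by rewrite -ltn_subRL.
exists (Ordinal lt_p); apply/existsP; exists (Ordinal lt_q) => /=.
by rewrite iso andbT [m + p]addnC leq_addr.
Qed.

Lemma occurs_nil sigma : occurs sigma [::] = false.
Proof. by rewrite occurs_has. Qed.

Lemma occurs_cons sigma x w :
  occurs sigma (x :: w) = starts sigma (x :: w) || occurs sigma w.
Proof.
rewrite !occurs_has /= -[1]/(1 + 0) iotaDl has_map.
by congr (_ || _); apply: eq_has.
Qed.

(** * Reductions, and words order-isomorphic to the two patterns *)

Lemma ltn_index_sort_undup (s : seq nat) x y : x \in s -> y \in s ->
  (index x (sort leq (undup s)) < index y (sort leq (undup s))) = (x < y).
Proof.
move=> xs ys; set S := sort _ _.
have S_sorted : sorted leq S := sort_sorted leq_total _.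
have mono u v : u \in s -> v \in s -> u < v -> index u S < index v S.
  move=> us vs lt_uv; rewrite ltnNge; apply/negP=> le_vu.
  have := sorted_leq_index leq_trans leqnn S_sorted v u.
  by rewrite !mem_sort !mem_undup => /(_ vs us le_vu); rewrite leqNgt lt_uv.
case: (ltngtP x y) => [||->]; last by rewrite ltnn.
- by move/mono->.
- by move/mono => /(_ ys xs)/ltnW; rewrite ltnNge => ->.
Qed.

Lemma reduction_three (s : seq nat) a b c : a < b -> b < c -> s =i [:: a; b; c] ->
  reduction s = [seq (index x [:: a; b; c]).+1 | x <- s].
Proof.
move=> ab bc eq_s; rewrite /reduction.
suff -> : sort leq (undup s) = [:: a; b; c] by [].
apply: (sorted_eq leq_trans anti_leq); rewrite ?sort_sorted //=.
- exact: leq_total.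
- by rewrite (ltnW ab) (ltnW bc).
rewrite perm_sort; apply: uniq_perm; rewrite ?undup_uniq //=.
  by rewrite !inE !negb_or !neq_ltn ab bc (ltn_trans ab bc).
by move=> x; rewrite mem_undup eq_s.
Qed.

Lemma ltn_reduction (s : seq nat) x y : x \in s -> y \in s ->
  (index x (sort leq (undup s))).+1 < (index y (sort leq (undup s))).+1 -> x < y.
Proof. by move=> xs ys; rewrite ltnS ltn_index_sort_undup. Qed.

(** Equal ranks force equal letters. Ranks are taken in [s], because [u] will be only the constant
    part of an occurrence. *)
Lemma map_index_nseq (s u : seq nat) i j : {subset u <= s} ->
  [seq (index x (sort leq (undup s))).+1 | x <- u] = nseq i j ->
  u = nseq i (head 0 u).
Proof.
move=> sub_u eq_u.
have size_u : size u = i by rewrite -(size_nseq i j) -eq_u size_map.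
rewrite -size_u; apply/all_pred1P.
case: u sub_u eq_u {size_u} => // a u sub_u eq_u.
have a_s : a \in s by rewrite sub_u // mem_head.
apply/allP=> x x_u /=; have x_s := sub_u _ x_u.
have idx z : z \in a :: u -> (index z (sort leq (undup s))).+1 = j.
  move=> /(map_f (fun x => (index x (sort leq (undup s))).+1)).
  by rewrite eq_u => /nseqP[].
have [eq_idx] : (index x (sort leq (undup s))).+1 = (index a (sort leq (undup s))).+1.
  by rewrite !idx // mem_head.
rewrite /= -[_ == _]negbK neq_ltn -(ltn_index_sort_undup a_s x_s).
by rewrite -(ltn_index_sort_undup x_s a_s) eq_idx ltnn.
Qed.

Lemma mem_1i32 (T : eqType) i (a b c : T) :
  0 < i -> rcons (rcons (nseq i a) c) b =i [:: a; b; c].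
Proof.
move=> i_gt0 x; rewrite !(mem_rcons, inE) mem_nseq i_gt0 /=.
by case: (x == a); case: (x == b); case: (x == c).
Qed.

Lemma mem_13i2 (T : eqType) i (a b c : T) :
  0 < i -> rcons (a :: nseq i c) b =i [:: a; b; c].
Proof.
move=> i_gt0 x; rewrite !(mem_rcons, inE) mem_nseq i_gt0 /=.
by case: (x == a); case: (x == b); case: (x == c).
Qed.

(** The pattern is its own reduction, so the letters of [rcons s b] have the ranks it displays:
    equal ranks give the block of [a], and the order of ranks gives [a < b < c]. *)
Lemma order_isomorphic_1i32 i (s : seq nat) b : 0 < i -> size s = i.+1 ->
  order_isomorphic (rcons s b) (rcons (rcons (nseq i 1) 3) 2) ->
  exists a c, s = rcons (nseq i a) c /\ a < b < c.
Proof.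
move=> i_gt0; case/lastP: s => // u c; rewrite size_rcons => -[size_u].
rewrite /order_isomorphic (@reduction_three (rcons _ 2) 1 2 3) //; last first.
  exact: mem_1i32.
rewrite !map_rcons map_nseq /= => /eqP.
(* Only the mapped copy of the word is unfolded; the ranks keep referring to [t]. *)
rewrite /reduction; set t := rcons _ _; rewrite {2}/t !map_rcons.
case/rcons_inj => /rcons_inj[eq_u eq_c] eq_b.
have u_nseq : u = nseq i (head 0 u).
  by apply: map_index_nseq eq_u => x x_u; rewrite !(mem_rcons, inE) x_u !orbT.
have a_u : head 0 u \in u by rewrite u_nseq; case: (i) i_gt0 => //= j _; rewrite mem_head.
have eq_a : (index (head 0 u) (sort leq (undup t))).+1 = 1.
  have := map_f (fun x => (index x (sort leq (undup t))).+1) a_u.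
  by rewrite eq_u => /nseqP[].
exists (head 0 u), c; split; first by rewrite -u_nseq.
by apply/andP; split; apply: (@ltn_reduction t);
  rewrite ?eq_a ?eq_b ?eq_c // !(mem_rcons, inE) ?a_u ?eqxx ?orbT.
Qed.

Lemma order_isomorphic_13i2 i (s : seq nat) b : 0 < i -> size s = i.+1 ->
  order_isomorphic (rcons s b) (rcons (1 :: nseq i 3) 2) ->
  exists a c, s = a :: nseq i c /\ a < b < c.
Proof.
move=> i_gt0; case: s => // a u [size_u].
rewrite /order_isomorphic (@reduction_three (rcons _ 2) 1 2 3) //; last first.
  exact: mem_13i2.
rewrite !map_rcons /= map_nseq /= => /eqP.
rewrite /reduction; set t := a :: _; rewrite {2}/t map_cons map_rcons.
have a_t : a \in t by rewrite mem_head.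
have b_t : b \in t by rewrite !(mem_rcons, inE) eqxx orbT.
have u_t : {subset u <= t} by move=> x x_u; rewrite !(mem_rcons, inE) x_u !orbT.
clearbody t; case=> eq_a /rcons_inj[eq_u eq_b].
have u_nseq : u = nseq i (head 0 u) by apply: map_index_nseq eq_u.
have c_u : head 0 u \in u by rewrite u_nseq; case: (i) i_gt0 => //= j _; rewrite mem_head.
have eq_c : (index (head 0 u) (sort leq (undup t))).+1 = 3.
  have := map_f (fun x => (index x (sort leq (undup t))).+1) c_u.
  by rewrite eq_u => /nseqP[].
exists a, (head 0 u); split; first by rewrite -u_nseq.
by apply/andP; split; apply: (@ltn_reduction t); rewrite ?eq_a ?eq_b ?eq_c // u_t.
Qed.

(** A word on exactly the letters 1, 2, 3 is its own reduction, so it is enough that [t] lists the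
    ranks of [s]. *)
Lemma order_isomorphic_three (s t : seq nat) a b c :
  a < b -> b < c -> s =i [:: a; b; c] -> t =i [:: 1; 2; 3] ->
  t = [seq (index x [:: a; b; c]).+1 | x <- s] -> order_isomorphic s t.
Proof.
move=> ab bc s3 t3 eq_t; rewrite /order_isomorphic.
rewrite (reduction_three ab bc s3) -eq_t (reduction_three _ _ t3) //.
apply/eqP; rewrite -[LHS]map_id; apply/eq_in_map => x.
by rewrite t3 !inE => /or3P[] /eqP->.
Qed.

Lemma starts_1i3_2P i w : 0 < i ->
  reflect (exists a c v, w = nseq i a ++ c :: v /\ straddled a c v)
          (starts (pattern_1i3_2 i) w).
Proof.
move=> i_gt0; rewrite /starts /= size_rcons size_nseq.
apply: (iffP hasP) => [[b b_w]|[a [c [v [-> /hasP[b b_v /andP[ab bc]]]]]]].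
  have lt_i : i.+1 < size w by rewrite -subn_gt0 -size_drop; case: (drop _ _) b_w.
  case/order_isomorphic_1i32 => //; first by rewrite size_takel // ltnW.
  move=> a [c [eq_s abc]]; exists a, c, (drop i.+1 w); split; last by apply/hasP; exists b.
  by rewrite -cat_rcons -eq_s cat_take_drop.
rewrite -cat_rcons; exists b; rewrite ?drop_size_cat ?take_size_cat ?size_rcons ?size_nseq //.
have ac := ltn_trans ab bc.
apply: (order_isomorphic_three ab bc).
- exact: mem_1i32.
- exact: mem_1i32.
- by rewrite !map_rcons map_nseq /= !eqxx (ltn_eqF ab) (ltn_eqF ac) (ltn_eqF bc).
Qed.

Lemma starts_13i_2P i w : 0 < i ->
  reflect (exists a c v, w = a :: nseq i c ++ v /\ straddled a c v)
          (starts (pattern_13i_2 i) w).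
Proof.
move=> i_gt0; rewrite /starts /= size_nseq.
apply: (iffP hasP) => [[b b_w]|[a [c [v [-> /hasP[b b_v /andP[ab bc]]]]]]].
  have lt_i : i.+1 < size w by rewrite -subn_gt0 -size_drop; case: (drop _ _) b_w.
  case/order_isomorphic_13i2 => //; first by rewrite size_takel // ltnW.
  move=> a [c [eq_s abc]]; exists a, c, (drop i.+1 w); split; last by apply/hasP; exists b.
  by rewrite -cat_cons -eq_s cat_take_drop.
rewrite -cat_cons; exists b; rewrite ?drop_size_cat ?take_size_cat /= ?size_nseq //.
have ac := ltn_trans ab bc.
apply: (order_isomorphic_three ab bc).
- exact: mem_13i2.
- exact: mem_13i2.
- by rewrite /= !map_rcons map_nseq /= !eqxx (ltn_eqF ab) (ltn_eqF ac) (ltn_eqF bc).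
Qed.

(** * Occurrences and avoidance read off the runs *)

(** The letter after the constant block differs from [x], so an occurrence beginning in this run
    begins exactly [i] letters before its end; such a position exists when the run has at least [i]
    letters. *)
Lemma occurs_1i3_2_run i e x w : 0 < i -> ohead w != Some x ->
  occurs (pattern_1i3_2 i) (nseq e.+1 x ++ w) =
  bad_ascent x w && (i <= e.+1) || occurs (pattern_1i3_2 i) w.
Proof.
move=> i_gt0 neq_x.
have startsE f : starts (pattern_1i3_2 i) (nseq f.+1 x ++ w) =
    (i == f.+1) && bad_ascent x w.
  apply/(starts_1i3_2P _ i_gt0)/andP => [[a [c [v [eq_w acv]]]]|[/eqP-> x_w]].
    have eq_a : a = x by case: (i) i_gt0 eq_w => // j _ [].
    rewrite {a}eq_a in eq_w acv *.
    have neq_c : ohead (c :: v) != Some x.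
      by apply: contraNneq (straddled_neq acv) => /= -[->].
    (* Both sides open with a maximal run of [x], of lengths [f.+1] and [i]; comparing them in both
       directions makes these equal. *)
    have [le_if eq_cv] := nseq_cat_inv neq_x eq_w.
    have [le_fi _] := nseq_cat_inv neq_c (esym eq_w).
    have eq_i : i = f.+1 by apply/eqP; rewrite eqn_leq le_if.
    by move: eq_cv; rewrite eq_i subnn /= => <-; rewrite eqxx.
  case: w x_w {neq_x} => // c v x_cv.
  by exists x, c, v.
elim: e => [|e IH].
  by rewrite occurs_cons (startsE 0) andbC; case: (i) i_gt0 => // -[].
rewrite [nseq e.+2 x ++ w]/= occurs_cons -[x :: x :: _]/(nseq e.+2 x ++ w).
rewrite startsE -[x :: _]/(nseq e.+1 x ++ w) IH [i <= e.+2]leq_eqVlt ltnS.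
by case: bad_ascent; rewrite ?andbT ?andbF ?orbA.
Qed.

(** Every copy of [x] but the last is followed by [x], whereas the pattern wants a different second
    letter. *)
Lemma occurs_13i_2_run i e x w : 0 < i ->
  occurs (pattern_13i_2 i) (nseq e.+1 x ++ w) =
  starts (pattern_13i_2 i) (x :: w) || occurs (pattern_13i_2 i) w.
Proof.
move=> i_gt0; elim: e => [|e IH]; first by rewrite occurs_cons.
rewrite -[nseq e.+2 x ++ w]/(x :: (nseq e.+1 x ++ w)) occurs_cons IH.
case: (starts_13i_2P (x :: (nseq e.+1 x ++ w)) i_gt0) => // -[a [c [v [[<-]]]]].
case: (i) i_gt0 => // j _ [<- _] /straddled_neq; by rewrite eqxx.
Qed.

(** Copies of [y] left over after the block cannot serve as the final letter, which must lie
    strictly below [y]. *)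
Lemma starts_13i_2_run i e x y w : 0 < i -> ohead w != Some y ->
  starts (pattern_13i_2 i) (x :: nseq e.+1 y ++ w) =
  straddled x y w && (i <= e.+1).
Proof.
move=> i_gt0 neq_y.
have straddled_run m : straddled x y (nseq m y ++ w) = straddled x y w.
  by rewrite /straddled has_cat has_nseq ltnn !andbF.
apply/(starts_13i_2P _ i_gt0)/andP => [[a [c [v [[<- eq_w] xcv]]]]|[xyw le_i]].
  have eq_c : c = y by case: (i) i_gt0 eq_w => // j _ [].
  rewrite {c}eq_c in eq_w xcv.
  have [le_i eq_v] := nseq_cat_inv (m := e.+1) neq_y eq_w.
  by rewrite eq_v straddled_run in xcv.
exists x, y, (nseq (e.+1 - i) y ++ w); split; last by rewrite straddled_run.
by rewrite catA -nseqD subnKC.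
Qed.

(** Badness depends on the run letters alone: copies of [y] never lie strictly below [y], and
    multiplicities further on do not affect which letters are present. *)
Lemma bad_ascent_unruns x r : bad_ascent x (unruns r) = bad_ascent x (unzip1 r).
Proof.
case: r => //= -[y e] r; rewrite /straddled /= has_cat has_nseq ltnn !andbF /=.
exact: has_unruns.
Qed.

Lemma ohead_unruns_path x (r : seq (nat * nat)) :
  path (@distinct_adjacent _) x (unzip1 r) -> ohead (unruns r) != Some x.
Proof.
rewrite ohead_unruns; case: (unzip1 r) => //= y s /andP[neq_xy _].
by apply: contraNneq neq_xy => -[->].
Qed.

Lemma avoids_1i3_2_unruns i (r : seq (nat * nat)) : 0 < i ->
  sorted (@distinct_adjacent _) (unzip1 r) ->
  avoids (pattern_1i3_2 i) (unruns r) = short_starts i bad_ascent r.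
Proof.
move=> i_gt0; rewrite /avoids; elim: r => [|[x e] r IH] /= x_r.
  by rewrite occurs_nil.
rewrite -[unruns _]/(nseq e.+1 x ++ unruns r).
rewrite occurs_1i3_2_run ?ohead_unruns_path // bad_ascent_unruns.
by rewrite negb_or negb_and -ltnNge -implybE IH ?(path_sorted x_r).
Qed.

Lemma avoids_13i_2_unruns i (r : seq (nat * nat)) : 0 < i ->
  sorted (@distinct_adjacent _) (unzip1 r) ->
  avoids (pattern_13i_2 i) (unruns r) = short_ends i bad_ascent r.
Proof.
move=> i_gt0; rewrite /avoids; elim: r => [|[x e] r IH] /= x_r.
  by rewrite occurs_nil.
rewrite -[unruns _]/(nseq e.+1 x ++ unruns r).
rewrite occurs_13i_2_run // negb_or IH ?(path_sorted x_r) //.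
congr (_ && _); case: r x_r {IH} => [|[y f] r] //= /andP[_ y_r].
rewrite -[unruns _]/(nseq f.+1 y ++ unruns r) starts_13i_2_run ?ohead_unruns_path //.
by rewrite negb_and -ltnNge -implybE /straddled has_unruns.
Qed.

(** * The bijection on words *)

Section Words.

Variable k : nat.
Implicit Types (w : seq 'I_k) (r : seq ('I_k * nat)).

Let letter (x : 'I_k) : nat := x.+1.

(** Stated over ['I_k] so that shifting stays within the alphabet; letters are raised by one to
    agree with [letters]. *)
Definition bad_letter (x : 'I_k) (w : seq 'I_k) : bool :=
  bad_ascent (letter x) (map letter w).

Definition shift_word w : seq 'I_k := unruns (shift_runs bad_letter (runs w)).

Lemma size_shift_word w : size (shift_word w) = size w.
Proof. by rewrite size_unruns shift_runs_total -size_unruns runsK. Qed.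

(** Shifting keeps the letters, so adjacent runs stay distinct and [runs] recovers the shifted
    encoding. *)
Lemma shift_word_inj : injective shift_word.
Proof.
move=> w1 w2 /(congr1 (@runs _)); rewrite !unrunsK ?shift_runs_letters ?runs_sorted //.
by move/shift_runs_inj/(congr1 (@unruns _)); rewrite !runsK.
Qed.

Let letter_runs r := [seq (letter p.1, p.2) | p <- r].

Let letter_runs_letters r : unzip1 (letter_runs r) = map letter (unzip1 r).
Proof. by rewrite /unzip1 -!map_comp. Qed.

Let letter_runs_sorted r : sorted (@distinct_adjacent _) (unzip1 r) ->
  sorted (@distinct_adjacent _) (unzip1 (letter_runs r)).
Proof.
move=> r_sorted; rewrite letter_runs_letters sorted_map.
apply: sub_sorted r_sorted => x y.
by apply: contra_neq => -[/val_inj].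
Qed.

Lemma avoids_shift_word i w : 0 < i ->
  avoids (pattern_13i_2 i) (map letter (shift_word w)) =
  avoids (pattern_1i3_2 i) (map letter w).
Proof.
move=> i_gt0; rewrite -{2}(runsK w) !map_unruns.
have r_sorted := runs_sorted w; set r := runs w in r_sorted *.
rewrite avoids_13i_2_unruns ?letter_runs_sorted ?shift_runs_letters //.
rewrite avoids_1i3_2_unruns ?letter_runs_sorted //.
(* Each side is carried from runs of natural numbers back to runs over ['I_k], where the shift was
   performed; the exponents are the same. *)
transitivity (short_ends i bad_letter (shift_runs bad_letter r)).
  elim: (shift_runs _ _) => //= -[x e] s /= <-.
  rewrite -[unzip1 _]/(unzip1 (letter_runs s)) letter_runs_letters; congr (_ && _).
  by case: s => [|[]].
rewrite short_ends_shift_runs //.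
elim: (r) => //= -[x e] s /= <-.
by rewrite -[X in bad_ascent _ X]/(unzip1 (letter_runs s)) letter_runs_letters.
Qed.

End Words.

Theorem theorem3p1 (i : nat) (hi : 2 <= i) :
  wilf_equivalent (pattern_1i3_2 i) (pattern_13i_2 i).
Proof.
move=> n k _; rewrite /avoid_count.
have size_shift (w : n.-tuple 'I_k) : size (shift_word w) == n.
  by rewrite size_shift_word size_tuple.
pose f w := Tuple (size_shift w).
have f_inj : injective f.
  by move=> w1 w2 /(congr1 val)/shift_word_inj/val_inj.
(* An injective self-map of a finite set preserves the cardinality of preimages; it remains to see
   that [f] pulls avoidance of [13^i-2] back to avoidance of [1^i3-2]. *)
rewrite -[RHS](card_preimset _ f_inj).
apply: eq_card => w; rewrite !inE.
by rewrite -[RHS]/(avoids _ _) (avoids_shift_word w (ltnW hi)).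
Qed.
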